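(* Let $0\le\alpha<1$ be fixed. Consider a Stochastic Block Model graph $\mathcal G(m,n-m,p,q)$ with two communities of equal size $m=n/2$ ($n$ even), with $p>q$ (possibly depending on $n$) such that $p+q\gg\log^3(n)/n$. Let $\boldsymbol\pi$ be the PageRank vector with damping factor $\alpha$ and preference (probability) vector $\mathbf v=\mathbf v^{(n)}$ such that $\|\mathbf v\|_2=O(1/\sqrt n)$. Then $$\|\boldsymbol\pi-\overline{\boldsymbol\pi}_{\mathrm{SBM}}\|_{TV}\to0\quad\text{w.h.p. as } n\to\infty,$$ where $$\overline{\boldsymbol\pi}_{\mathrm{SBM}}=\alpha\frac1n\mathbf 1+(1-\alpha)\left(\mathbf v+\frac{\alpha\beta}{1-\alpha\beta}(\mathbf v^T\mathbf u)\,\mathbf u\right),$$ $\beta=\frac{p-q}{p+q}$, and $\mathbf u\in\mathbb R^n$ is the unit vector with $u_i=\frac1{\sqrt n}$ for $i\in C_1$ and $u_i=-\frac1{\sqrt n}$ for $i\in C_2$.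
   Context: Stochastic Block Model $\mathcal G(m,n-m,p,q)$ with two communities: an undirected random graph on $V=C_1\cup C_2$, $C_1,C_2$ disjoint, $|C_1|=m$, $|C_2|=n-m$; edges are independent; two vertices in the same community are joined with probability $p$ and two vertices in different communities with probability $q$, with $p>q$. Self-loops ($i=j$) are allowed with probability $p$, so that for $m=n/2$ every expected degree is exactly $\frac n2(p+q)$. $\mathbf A$ is the symmetric $0/1$ adjacency matrix, $\mathbf D=\mathrm{diag}(d_1,\dots,d_n)$ with $d_i=\sum_jA_{ij}$, $\mathbf P=\mathbf A\mathbf D^{-1}$ (defined when all degrees are positive, part of the w.h.p. event), $\mathbf 1$ the all-ones vector. PageRank: for a (deterministic) probability vector $\mathbf v$ and $\alpha<1$, $\boldsymbol\pi=(1-\alpha)[\mathbf I-\alpha\mathbf P]^{-1}\mathbf v$, equivalently the stationary probability vector of $\alpha\mathbf P+(1-\alpha)\mathbf v\mathbf 1^T$. $\|u-v\|_{TV}=\frac12\sum_i|u_i-v_i|$; $\|\mathbf x\|_2=\sqrt{\sum_i|x_i|^2}$. $f(n)\gg g(n)$ means $g(n)=o(f(n))$ as $n\to\infty$. An event (depending on $n$) holds with high probability (w.h.p.) if there are $N$ and $c>0$ such that its probability is at least $1-O(n^{-c})$ for all $n>N$. Nonnegative random variables $X_n$ satisfy $X_n=o(1)$ (equivalently $X_n\to0$) w.h.p. if there is a deterministic function $\psi(n)=o(1)$ such that the event $\{X_n\le\psi(n)\}$ holds w.h.p. *)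

(* Defs.v *)
From HB Require Import structures.
From mathcomp Require Import all_boot all_order all_algebra.
From mathcomp Require Import all_classical all_reals all_analysis.
Set Implicit Arguments.
Unset Strict Implicit.
Unset Printing Implicit Defensive.
Import Order.TTheory GRing.Theory Num.Theory.
Import numFieldNormedType.Exports.
Local Open Scope classical_set_scope.
Local Open Scope ring_scope.

(* n tends to infinity through the even numbers *)
Notation even_oo := (within [set n : nat | ~~ odd n] \oo).

Section vectors.
Context {R : realType} {n : nat}.
Implicit Types x y : 'cV[R]_n.

Definition norm2 x : R := Num.sqrt (\sum_i `|x i 0| ^+ 2).

Definition dTV x y : R := 2^-1 * \sum_i `|x i 0 - y i 0|.

Definition prob_vector x : Prop :=
  (forall i, 0 <= x i 0) /\ \sum_i x i 0 = 1.

End vectors.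

(* A graph on 'I_n with self-loops allowed is a symmetric boolean matrix;
   a self-loop at i is the entry G i i. *)
Section pagerank.
Context {R : realType} {n : nat}.
Implicit Type G : 'M[bool]_n.

Definition adjacency G : 'M[R]_n := \matrix_(i, j) (G i j)%:R.

(* a self-loop contributes 1 *)
Definition degree G (i : 'I_n) : R := \sum_j adjacency G i j.

Definition positive_degrees G : bool := [forall i, 0 < degree G i].

Definition transition G : 'M[R]_n :=
  adjacency G *m invmx (diag_mx (\row_i degree G i)).

(* meaningful only if positive_degrees G: invmx is the identity on
   non-invertible matrices *)
Definition pagerank (alpha : R) (v : 'cV[R]_n) G : 'cV[R]_n :=
  (1 - alpha) *: (invmx (1%:M - alpha *: transition G) *m v).

End pagerank.

(* The block model with communities C and ~: C; its law is the product of the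
   Bernoulli laws of the unordered pairs {i, j}, represented by i <= j. *)
Section sbm.
Context {R : realType} {n : nat}.
Variables (C : {set 'I_n}) (p q : R).

Definition edge_prob (i j : 'I_n) : R :=
  if (i \in C) == (j \in C) then p else q.

Definition sbm_pmf (G : 'M[bool]_n) : R :=
  if G^T == G then
    \prod_(i < n) \prod_(j < n | (i <= j)%N)
      (if G i j then edge_prob i j else 1 - edge_prob i j)
  else 0.

Definition sbm_prob (E : pred 'M[bool]_n) : R := \sum_(G | E G) sbm_pmf G.

End sbm.

Section high_probability.
Context {R : realType}.

(* Pr n is the probability of the n-th event *)
Definition whp (Pr : nat -> R) : Prop :=
  exists2 c : R, 0 < c &
  exists K : R, \forall n \near even_oo, 1 - K * n%:R `^ (- c) <= Pr n.

(* X n tends to 0 w.h.p. under Pr n; X n is defined only on dom n, and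
   membership in dom n is part of the event of high probability. *)
Definition cvg0_whp (T : nat -> finType) (Pr : forall n, pred (T n) -> R)
    (dom : forall n, pred (T n)) (X : forall n, T n -> R) : Prop :=
  exists2 psi : nat -> R, psi n @[n --> even_oo] --> (0 : R) &
  whp (fun n => Pr n [pred w | dom n w && (X n w <= psi n)]).

End high_probability.

Section limit.
Context {R : realType} {n : nat}.

Definition community_vector (C : {set 'I_n}) : 'cV[R]_n :=
  \col_i (if i \in C then (Num.sqrt n%:R)^-1 else - (Num.sqrt n%:R)^-1).

Definition pagerank_sbm (alpha p q : R) (C : {set 'I_n}) (v : 'cV[R]_n) :
    'cV[R]_n :=
  let beta := (p - q) / (p + q) in
  let u := community_vector C in
  alpha *: (n%:R^-1 *: const_mx 1) +
  (1 - alpha) *: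
    (v + (alpha * beta / (1 - alpha * beta) * (v^T *m u) 0 0) *: u).

End limit.

(* Main.v *)
Require Import Defs.
From HB Require Import structures.
From mathcomp Require Import all_boot all_order all_algebra.
From mathcomp Require Import all_classical all_reals all_analysis.
From mathcomp Require Import ring lra.
Set Implicit Arguments.
Unset Strict Implicit.
Unset Printing Implicit Defensive.
Import Order.TTheory GRing.Theory Num.Theory.
Import numFieldNormedType.Exports.
Local Open Scope classical_set_scope.
Local Open Scope ring_scope.

(** The limit vector [w] solves the averaged PageRank equation
    [w = alpha Pbar w + (1 - alpha) v], where [Pbar i j] is the edge probability
    of [i, j] divided by the common expected degree [d = n (p + q) / 2]:
    indeed [Pbar] has rank two, [Pbar = 1 1^T / n + beta u u^T], with [u]
    orthogonal to the all-ones vector ([pagerank_sbm_fixed]).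

    Let [P] be the random transition matrix.  Its columns sum to one, so it
    contracts the l1 norm, and subtracting the two fixed-point equations gives
    [|pi - w|_1 <= alpha / (1 - alpha) * |(P - Pbar) w|_1]
    ([pagerank_perturbation]).  The vector [w] is deterministic, so spectral
    bounds on the random matrix can be avoided altogether: it is enough to
    control [(P - Pbar) w], which splits into the relative fluctuations of the
    degrees and [|(A - E A) w|_1 / d] ([pagerank_deviation]).

    Both are functions of independent Bernoulli edges with bounded differences
    [c e], and a Bernstein form of McDiarmid's inequality
    ([bounded_differences_tail]) controls them, with variance proxy
    [\sum_e a e * c e ^+ 2] for edge probabilities [a e].  For a degree the
    proxy is [d]; with [r = ln n / d], which tends to 0, all the relative
    degree errors are at most [4 sqrt r] outside an event of probability
    [O(1 / n)].  For [|(A - E A) w|_1] the proxy is at most [2 d |w|_2 ^ 2],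
    a bounded quantity since [|w|_2 = O(n^(-1/2))], so the fluctuation around
    the mean is [O(ln n)]; the mean is at most [sqrt (n d) |w|_2 = O(sqrt d)] by
    the variance bound [bounded_differences_second_moment].  Dividing by [d],
    all the errors are [O(sqrt r)] ([pagerank_sbm_prob]). *)

(** * Elementary inequalities *)

Section real_inequalities.
Context {R : realType}.

(** From [exp (- x) >= 1 - x]: the product [(1 - x) (1 + x + 2 x ^ 2)] equals
    [1 + x ^ 2 (1 - 2 x)], which is at least 1 on this range. *)
Lemma expR_le_quadratic (x : R) : x <= 1 / 2 -> expR x <= 1 + x + 2 * x ^+ 2.
Proof.
move=> x2.
have x1 : 0 < 1 - x by lra.
have ex : 1 - x <= expR (- x) by have := expR_ge1Dx (- x); lra.
rewrite -[x in expR x]opprK expRN.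
apply: (@le_trans _ _ (1 - x)^-1); first by rewrite lef_pV2 ?posrE ?expR_gt0.
rewrite -(ler_pM2l x1) divff ?gt_eqF//.
have : 0 <= x ^+ 2 * (1 - 2 * x) by rewrite mulr_ge0 ?sqr_ge0//; lra.
nra.
Qed.

(** One step of the martingale argument: a Bernoulli variable with values [g1]
    and [g0] deviates from its mean by [(1 - a) D] or [- a D], where
    [D = g1 - g0].  In the quadratic bound the linear terms cancel, leaving the
    variance [a (1 - a) D ^ 2]; keeping the factor [a] is what makes the final
    inequality sensitive to the sparsity of the graph. *)
Lemma two_point_mgf (a c l g1 g0 : R) : 0 <= a <= 1 -> 0 <= l ->
  `|g1 - g0| <= c -> l * c <= 1 / 2 ->
  a * expR (l * g1) + (1 - a) * expR (l * g0) <=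
  expR (l * (a * g1 + (1 - a) * g0) + 2 * l ^+ 2 * (a * c ^+ 2)).
Proof.
move=> /andP[a0 a1] l0 gc lc.
set m := a * g1 + (1 - a) * g0; pose D := g1 - g0.
have -> : l * g1 = l * m + (1 - a) * (l * D) by rewrite /m /D; ring.
have -> : l * g0 = l * m + (- a * (l * D)) by rewrite /m /D; ring.
have lD : `|l * D| <= 1 / 2.
  by rewrite normrM (ger0_norm l0) (le_trans _ lc)// ler_wpM2l.
have D2 : D ^+ 2 <= c ^+ 2.
  by rewrite -[D ^+ 2]real_normK ?num_real// lerXn2r ?nnegrE// (le_trans _ gc).
have /andP[lD1 lD2] : - (1 / 2) <= l * D <= 1 / 2 by rewrite -ler_norml.
rewrite !expRD mulrCA [X in _ + X]mulrCA -mulrDr ler_wpM2l ?expR_ge0//.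
have e1 : expR ((1 - a) * (l * D)) <=
    1 + (1 - a) * (l * D) + 2 * ((1 - a) * (l * D)) ^+ 2.
  by apply: expR_le_quadratic; nra.
have e0 : expR (- a * (l * D)) <=
    1 + (- a * (l * D)) + 2 * (- a * (l * D)) ^+ 2.
  by apply: expR_le_quadratic; nra.
apply: le_trans (expR_ge1Dx _).
apply: (@le_trans _ _ (1 + 2 * (a * (1 - a)) * l ^+ 2 * D ^+ 2)).
  have := ler_wpM2l a0 e1.
  have a1' : 0 <= 1 - a by lra.
  have := ler_wpM2l a1' e0.
  set E1 := expR _; set E0 := expR _ => h0 h1.
  by apply: le_trans (lerD h1 h0) _; rewrite le_eqVlt; apply/orP; left; apply/eqP; ring.
rewrite lerD2l.
have aa : a * (1 - a) <= a by nra.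
have -> : 2 * l ^+ 2 * (a * c ^+ 2) = 2 * a * l ^+ 2 * c ^+ 2 by ring.
have aa0 : 0 <= a * (1 - a) by rewrite mulr_ge0//; lra.
have l20 := sqr_ge0 l.
have coef_ge0 : 0 <= 2 * (a * (1 - a)) * l ^+ 2 by rewrite mulr_ge0// mulr_ge0.
apply: le_trans (ler_wpM2l coef_ge0 D2) _.
by rewrite ler_wpM2r ?sqr_ge0// ler_wpM2r// ler_wpM2l.
Qed.

(** Exact second moment, with the variance [a (1 - a) (g1 - g0) ^ 2] bounded. *)
Lemma two_point_variance (a c g1 g0 : R) : 0 <= a <= 1 -> `|g1 - g0| <= c ->
  a * g1 ^+ 2 + (1 - a) * g0 ^+ 2 <= (a * g1 + (1 - a) * g0) ^+ 2 + a * c ^+ 2.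
Proof.
move=> /andP[a0 a1] gc.
have D2 : (g1 - g0) ^+ 2 <= c ^+ 2.
  by rewrite -[(g1 - g0) ^+ 2]real_normK ?num_real// lerXn2r ?nnegrE// (le_trans _ gc).
have : a * (1 - a) * (g1 - g0) ^+ 2 <= a * c ^+ 2.
  have aa0 : 0 <= a * (1 - a) by rewrite mulr_ge0//; lra.
  apply: le_trans (ler_wpM2l aa0 D2) _.
  by rewrite ler_wpM2r ?sqr_ge0// ler_piMr//; lra.
rewrite -lerBlDl; apply: le_trans; rewrite le_eqVlt; apply/orP; left; apply/eqP; ring.
Qed.

Lemma cauchy_schwarz_sum (I : finType) (x y : I -> R) :
  (\sum_i x i * y i) ^+ 2 <= (\sum_i x i ^+ 2) * (\sum_i y i ^+ 2).
Proof.
pose X := \sum_i x i ^+ 2; pose Y := \sum_i y i ^+ 2; pose Z := \sum_i x i * y i.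
have H (s t : R) : 0 <= s ^+ 2 * X - 2 * (s * t) * Z + t ^+ 2 * Y.
  rewrite /X /Y /Z !mulr_sumr -sumrB -big_split/= sumr_ge0// => i _.
  have -> : s ^+ 2 * x i ^+ 2 - 2 * (s * t) * (x i * y i) + t ^+ 2 * y i ^+ 2
    = (s * x i - t * y i) ^+ 2 by ring.
  exact: sqr_ge0.
rewrite -/X -/Y -/Z.
have X0 : 0 <= X by apply: sumr_ge0 => i _; exact: sqr_ge0.
have := H Z X.
(* [H Z X] reads [0 <= X * (X * Y - Z ^+ 2)]. *)
have [X00|] := eqVneq X 0.
  rewrite X00 mul0r => _.
  have x0 i : x i = 0.
    move/eqP: X00; rewrite psumr_eq0 => [/allP/(_ i (mem_index_enum _))/=|j _].
      by rewrite sqrf_eq0 => /eqP.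
    exact: sqr_ge0.
  by rewrite /Z big1 ?expr0n//= => i _; rewrite x0 mul0r.
move=> Xn0.
have Xp : 0 < X by rewrite lt_def Xn0.
have -> : Z ^+ 2 * X - 2 * (Z * X) * Z + X ^+ 2 * Y = X * (X * Y - Z ^+ 2) by ring.
by rewrite pmulr_rge0// subr_ge0.
Qed.

Lemma sqr_sum_le (I : finType) (b : I -> bool) (x : I -> R) :
  (\sum_i (b i)%:R * x i) ^+ 2 <= (\sum_i (b i)%:R) * (\sum_i (b i)%:R * x i ^+ 2).
Proof.
have := cauchy_schwarz_sum (fun i => (b i)%:R) (fun i => (b i)%:R * x i).
congr (_ <= _).
  by congr (_ ^+ 2); apply: eq_bigr => i _; case: (b i); rewrite ?mul1r ?mul0r.
by congr (_ * _); apply: eq_bigr => i _; case: (b i);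
  rewrite ?mul1r ?mul0r ?expr1n ?expr0n.
Qed.

Lemma sum_indicator (I : finType) (b : pred I) :
  \sum_i (b i)%:R = #|b|%:R :> R.
Proof.
by rewrite -sum1_card natr_sum [RHS]big_mkcond/=; apply: eq_bigr => i _;
  rewrite -topredE/=; case: (b i).
Qed.

Lemma sum_indicator_eq (I : finType) (i : I) (F : I -> R) :
  \sum_e F e * (i == e)%:R = F i.
Proof.
rewrite (bigD1 i)//= eqxx mulr1 big1 ?addr0// => e /negbTE.
by rewrite eq_sym => ->; rewrite mulr0.
Qed.

End real_inequalities.

(** * Concentration on a product of Bernoulli laws *)

Section bernoulli_product.
Context {R : realType} {I : finType}.
Variable a : I -> R.
Hypothesis a01 : forall e, 0 <= a e <= 1.
Implicit Types (w : {ffun I -> bool}) (f g : {ffun I -> bool} -> R).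
Implicit Types (c : I -> R) (s : seq I).

Definition bernoulli_pmf w : R := \prod_e (if w e then a e else 1 - a e).

Definition expect f : R := \sum_w bernoulli_pmf w * f w.

Definition update w e b : {ffun I -> bool} :=
  [ffun x => if x == e then b else w x].

Lemma updateE w e b x : update w e b x = if x == e then b else w x.
Proof. exact: ffunE. Qed.

(** Conditional expectation given all the coordinates but [e], written as an
    operator on functions of the whole configuration, so that integrating out
    coordinates one by one is a plain induction on a list. *)
Definition average e f : {ffun I -> bool} -> R :=
  fun w => a e * f (update w e true) + (1 - a e) * f (update w e false).

Definition averages s f := foldr average f s.

Definition bounded_differences c f :=
  forall e w, `|f (update w e true) - f (update w e false)| <= c e.

Lemma bernoulli_pmf_ge0 w : 0 <= bernoulli_pmf w.
Proof.
apply: prodr_ge0 => e _; have /andP[a0 a1] := a01 e.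
by case: ifP => _; rewrite ?subr_ge0.
Qed.

Lemma sum_bernoulli_pmf : \sum_w bernoulli_pmf w = 1.
Proof.
rewrite /bernoulli_pmf.
rewrite -(bigA_distr_bigA (fun e (b : bool) => if b then a e else 1 - a e)).
by rewrite big1// => e _; rewrite big_bool/= addrC subrK.
Qed.

Lemma expect_le f g : (forall w, f w <= g w) -> expect f <= expect g.
Proof.
by move=> fg; apply: ler_sum => w _; rewrite ler_wpM2l ?bernoulli_pmf_ge0.
Qed.

Lemma expect_cst r : expect (fun=> r) = r.
Proof. by rewrite /expect -mulr_suml sum_bernoulli_pmf mul1r. Qed.

Lemma expectD f g : expect (fun w => f w + g w) = expect f + expect g.
Proof. by rewrite /expect -big_split; apply: eq_bigr => w _; rewrite mulrDr. Qed.

Lemma expectZ r f : expect (fun w => r * f w) = r * expect f.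
Proof. by rewrite /expect mulr_sumr; apply: eq_bigr => w _; rewrite mulrCA. Qed.

Lemma expect_sum (J : finType) (f : J -> {ffun I -> bool} -> R) :
  expect (fun w => \sum_j f j w) = \sum_j expect (f j).
Proof.
rewrite /expect exchange_big/=; apply: eq_bigr => w _; exact: mulr_sumr.
Qed.

Lemma updateC w e e' b b' : e != e' ->
  update (update w e b) e' b' = update (update w e' b') e b.
Proof.
move=> ee'; apply/ffunP => x; rewrite !ffunE.
by case: (eqVneq x e') => [->|//]; rewrite eq_sym (negbTE ee').
Qed.

Lemma updateK w e b b' : update (update w e b) e b' = update w e b'.
Proof. by apply/ffunP => x; rewrite !ffunE; case: eqP. Qed.

(** Pair each configuration with the one obtained by flipping [e]: within a pair
    the weights are those of the two-point law at [e], up to a common factor. *)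
Lemma expect_average e f : expect (average e f) = expect f.
Proof.
pose flip w := update w e (~~ w e).
have flipK : involutive flip.
  move=> w; apply/ffunP => x; rewrite !ffunE eqxx negbK.
  by case: eqP => // ->.
pose k (b : bool) := if b then a e else 1 - a e.
pose W w := \prod_(x | x != e) (if w x then a x else 1 - a x).
have pmfE w : bernoulli_pmf w = k (w e) * W w by rewrite /bernoulli_pmf (bigD1 e).
have WE w : W (flip w) = W w.
  by apply: eq_bigr => x xe; rewrite ffunE (negbTE xe).
have updE w : update w e (w e) = w.
  by apply/ffunP => x; rewrite ffunE; case: eqP => // ->.
have avE w : average e f w = k (w e) * f w + k (~~ w e) * f (flip w).
  rewrite /average /flip; case we : (w e); rewrite -[in f w](updE w) we//=.
  exact: addrC.
rewrite /expect (eq_bigr (fun w => k (w e) * k (w e) * (W w * f w) +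
    k (~~ w e) * k (w e) * (W w * f (flip w)))) => [|w _]; last first.
  by rewrite pmfE avE; ring.
rewrite big_split/= [X in _ + X](reindex_inj (inv_inj flipK))/= -big_split/=.
apply: eq_bigr => w _.
rewrite flipK WE pmfE.
have -> : flip w e = ~~ w e by rewrite ffunE eqxx.
by rewrite negbK /k; case: (w e) => /=; ring.
Qed.

Lemma expect_averages s f : expect (averages s f) = expect f.
Proof. by elim: s => //= e s IH; rewrite expect_average. Qed.

Lemma averages_local s f w w' : (forall e, e \notin s -> w e = w' e) ->
  averages s f w = averages s f w'.
Proof.
elim: s w w' => [|e s IH] w w' ww'.
  by congr f; apply/ffunP => e; exact: ww'.
rewrite /= /average; congr (_ * _ + _ * _); apply: IH => x xs; rewrite !ffunE;
by case: (eqVneq x e) => // xe; apply: ww'; rewrite inE negb_or xe.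
Qed.

(** After averaging over every coordinate the function is constant, by
    [averages_local], hence equal to its expectation. *)
Lemma averages_enum f w : averages (enum I) f w = expect f.
Proof.
rewrite -(expect_averages (enum I)) -[LHS]expect_cst; apply: eq_bigr => w' _.
by congr (_ * _); apply: averages_local => e; rewrite mem_enum.
Qed.

Lemma average_bounded_differences c e f :
  bounded_differences c f -> bounded_differences c (average e f).
Proof.
move=> cf e' w; rewrite /average.
have [<-|ee'] := eqVneq e e'.
  by rewrite !updateK subrr normr0 (le_trans _ (cf e w)).
rewrite ![update (update w e' _) e _](updateC _ _ _ (_ : e' != e)) 1?eq_sym//.
have /andP[a0 a1] := a01 e.
set x1 := f _; set x2 := f _; set x3 := f _; set x4 := f _.
have -> : a e * x1 + (1 - a e) * x2 - (a e * x3 + (1 - a e) * x4) =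
  a e * (x1 - x3) + (1 - a e) * (x2 - x4) by ring.
rewrite (le_trans (ler_normD _ _))// !normrM (ger0_norm a0).
rewrite [`|1 - a e|]ger0_norm ?subr_ge0//.
have h1 : a e * `|x1 - x3| <= a e * c e' by rewrite ler_wpM2l//; exact: cf.
have h2 : (1 - a e) * `|x2 - x4| <= (1 - a e) * c e'.
  by rewrite ler_wpM2l ?subr_ge0//; exact: cf.
by apply: le_trans (lerD h1 h2) _; rewrite -mulrDl addrC subrK mul1r.
Qed.

Lemma averages_bounded_differences c s f :
  bounded_differences c f -> bounded_differences c (averages s f).
Proof. by move=> cf; elim: s => //= e s; apply: average_bounded_differences. Qed.

Lemma average_le e f g : (forall w, f w <= g w) ->
  forall w, average e f w <= average e g w.
Proof.
move=> fg w; have /andP[a0 a1] := a01 e.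
by rewrite lerD// ler_wpM2l// subr_ge0.
Qed.

(** Integrating out the coordinates of [s] costs one factor of [two_point_mgf]
    each, since partial averages keep the bounded differences of [f]. *)
Lemma averages_mgf c f l s w : bounded_differences c f -> 0 <= l ->
  (forall e, l * c e <= 1 / 2) ->
  averages s (fun w => expR (l * f w)) w <=
  expR (l * averages s f w + 2 * l ^+ 2 * \sum_(e <- s) a e * c e ^+ 2).
Proof.
move=> cf l0 lc; elim: s w => [|e s IH] w /=; first by rewrite big_nil mulr0 addr0.
apply: le_trans (average_le _ IH _) _.
rewrite /average big_cons; set V := \sum_(_ <- _) _.
rewrite [2 * l ^+ 2 * (_ + V)]mulrDr addrA !(expRD _ (2 * l ^+ 2 * V)).
rewrite ![_ * (_ * expR (2 * l ^+ 2 * V))]mulrA -mulrDl ler_wpM2r ?expR_ge0//.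
exact: two_point_mgf (a01 e) l0 (averages_bounded_differences _ cf _ _) (lc e).
Qed.

Lemma averages_variance c f s w : bounded_differences c f ->
  averages s (fun w => f w ^+ 2) w <=
  averages s f w ^+ 2 + \sum_(e <- s) a e * c e ^+ 2.
Proof.
move=> cf; elim: s w => [|e s IH] w /=; first by rewrite big_nil addr0.
apply: le_trans (average_le _ IH _) _.
rewrite /average big_cons addrA.
set V := \sum_(_ <- _) _.
have -> (x y : R) : a e * (x + V) + (1 - a e) * (y + V) =
  a e * x + (1 - a e) * y + V by ring.
rewrite lerD2r.
exact: two_point_variance (a01 e) (averages_bounded_differences _ cf _ _).
Qed.

Lemma bounded_differences_mgf c f l : bounded_differences c f -> 0 <= l ->
  (forall e, l * c e <= 1 / 2) ->
  expect (fun w => expR (l * f w)) <=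
  expR (l * expect f + 2 * l ^+ 2 * \sum_e a e * c e ^+ 2).
Proof.
move=> cf l0 lc; have := averages_mgf (enum I) [ffun=> true] cf l0 lc.
by rewrite !averages_enum big_enum.
Qed.

(** Efron-Stein inequality, by the same induction on coordinates. *)
Lemma bounded_differences_second_moment c f : bounded_differences c f ->
  expect (fun w => f w ^+ 2) <= expect f ^+ 2 + \sum_e a e * c e ^+ 2.
Proof.
move=> cf; have := averages_variance (enum I) [ffun=> true] cf.
by rewrite !averages_enum big_enum.
Qed.

Lemma expect_sqr_le f : expect f ^+ 2 <= expect (fun w => f w ^+ 2).
Proof.
have : 0 <= expect (fun w => (f w - expect f) ^+ 2).
  rewrite -(expect_cst 0); apply: expect_le => w; exact: sqr_ge0.
have -> : (fun w => (f w - expect f) ^+ 2) =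
    (fun w => f w ^+ 2 + ((- 2 * expect f) * f w + expect f ^+ 2)).
  by apply/funext => w; ring.
rewrite expectD expectD expectZ expect_cst; nra.
Qed.

Definition prob (E : pred {ffun I -> bool}) : R := expect (fun w => (E w)%:R).

Lemma prob_le (E F : pred {ffun I -> bool}) : {subset E <= F} -> prob E <= prob F.
Proof.
move=> EF; apply: expect_le => w; have := EF w; rewrite /in_mem/=.
by case: (E w) => [->//|_]; rewrite ler_nat.
Qed.

(** Bernstein form of McDiarmid's inequality, by Markov's inequality for
    [expR (l * f)].  The weights [a e] in the variance proxy replace the
    worst-case Bernoulli variance 1/4 of the usual form, at the price of the
    bound on [l]. *)
Lemma bounded_differences_tail c f l t : bounded_differences c f -> 0 <= l ->
  (forall e, l * c e <= 1 / 2) ->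
  prob (fun w => t < f w - expect f) <=
  expR (- (l * t) + 2 * l ^+ 2 * \sum_e a e * c e ^+ 2).
Proof.
move=> cf l0 lc; have := bounded_differences_mgf cf l0 lc.
set V := \sum_e _ => H.
have -> : - (l * t) + 2 * l ^+ 2 * V =
  - (l * (expect f + t)) + (l * expect f + 2 * l ^+ 2 * V) by ring.
rewrite expRD; apply: le_trans (ler_wpM2l (expR_ge0 _) H).
rewrite -expectZ; apply: expect_le => w; rewrite -expRD.
case: ltP => [tf|_]; last exact: expR_ge0.
apply: le_trans (expR_ge1Dx _); rewrite lerDl.
have -> : - (l * (expect f + t)) + l * f w = l * (f w - expect f - t) by ring.
by rewrite mulr_ge0// subr_ge0 ltW.
Qed.

Lemma bounded_differences_tail_abs c f l t : bounded_differences c f -> 0 <= l ->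
  (forall e, l * c e <= 1 / 2) ->
  prob (fun w => t < `|f w - expect f|) <=
  2 * expR (- (l * t) + 2 * l ^+ 2 * \sum_e a e * c e ^+ 2).
Proof.
move=> cf l0 lc.
have ncf : bounded_differences c (fun w => - f w).
  by move=> e w; rewrite -opprD normrN.
rewrite mulr_natl mulr2n; apply: le_trans (lerD
  (bounded_differences_tail t cf l0 lc) (bounded_differences_tail t ncf l0 lc)).
rewrite -expectD; apply: expect_le => w.
have -> : expect (fun w => - f w) = - expect f.
  by rewrite -mulN1r -expectZ; apply: eq_bigr => w' _; rewrite mulN1r.
rewrite -opprD -natrD ler_nat; case: ltP => // tf.
have [f0|f0] := leP 0 (f w - expect f).
  by rewrite ger0_norm// in tf; rewrite tf.
by rewrite ltr0_norm// in tf; rewrite tf addn1.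
Qed.

Lemma expect_coord e : expect (fun w => (w e)%:R) = a e.
Proof.
rewrite -(expect_average e) -[RHS]expect_cst; apply: eq_bigr => w _.
by rewrite /average !ffunE eqxx mulr1 mulr0 addr0.
Qed.

End bernoulli_product.

(** * The stochastic block model as a product law *)

Section edges.
Context {n : nat}.

Definition edge := {e : 'I_n * 'I_n | e.1 <= e.2}%N.

Lemma edge_between_subproof (i j : 'I_n) :
  let e := if (i <= j)%N then (i, j) else (j, i) in (e.1 <= e.2)%N.
Proof. by case: leqP => //= /ltnW. Qed.

Definition edge_between i j : edge :=
  exist (fun e : 'I_n * 'I_n => e.1 <= e.2)%N _ (edge_between_subproof i j).

Lemma edge_betweenC i j : edge_between i j = edge_between j i.
Proof.
apply: val_inj => /=; case: (ltngtP i j) => // ij.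
by rewrite (val_inj ij : i = j).
Qed.

Lemma edge_betweenK (e : edge) : edge_between (val e).1 (val e).2 = e.
Proof. by apply: val_inj; case: e => -[i j] /= ->. Qed.

Lemma edge_between_inj i j k :
  edge_between i j = edge_between i k -> j = k.
Proof.
move/(congr1 val) => /=; case: leqP => _; case: leqP => _ []//; congruence.
Qed.

Lemma edge_between_eq i j (e : edge) : (edge_between i j == e) =
  ((i, j) == val e) || ((j, i) == val e).
Proof.
apply/eqP/orP => [<-/=|[] /eqP ij]; last first.
- by rewrite edge_betweenC -[RHS]edge_betweenK -ij.
- by rewrite -[RHS]edge_betweenK -ij.
by case: ifP => _; [left | right].
Qed.

Definition graph (w : {ffun edge -> bool}) : 'M[bool]_n :=
  \matrix_(i, j) w (edge_between i j).

Lemma graph_sym w : (graph w)^T = graph w.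
Proof. by apply/matrixP => i j; rewrite !mxE edge_betweenC. Qed.

End edges.
Arguments edge n : clear implicits.

Section sbm_product.
Context {R : realType} {n : nat}.
Variables (C : {set 'I_n}) (p q : R).

Definition edge_law (e : edge n) : R := edge_prob C p q (val e).1 (val e).2.

Lemma edge_probC i j : edge_prob C p q i j = edge_prob C p q j i.
Proof. by rewrite /edge_prob eq_sym. Qed.

Lemma edge_law_between i j : edge_law (edge_between i j) = edge_prob C p q i j.
Proof. by rewrite /edge_law /=; case: ifP => //= _; exact: edge_probC. Qed.

(** A symmetric matrix is the same thing as its upper triangle, and the weight
    of a graph is the product weight of its upper triangle. *)
Lemma sbm_prob_product (E : pred 'M[bool]_n) :
  sbm_prob C p q E = prob edge_law (fun w => E (graph w)).
Proof.
rewrite /sbm_prob /prob /expect.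
rewrite (bigID (fun G : 'M[bool]_n => G^T == G))/= [X in _ + X]big1 ?addr0; last first.
  by move=> G /andP[_ /negbTE Gs]; rewrite /sbm_pmf Gs.
rewrite (reindex_onto (@graph n)
    (fun G => [ffun e : edge n => G (val e).1 (val e).2])); last first.
  move=> G /andP[_ /eqP Gs]; apply/matrixP => i j; rewrite !mxE ffunE /=.
  by case: ifP => //= _; rewrite -[in RHS]Gs mxE.
rewrite [RHS]big_mkcond [LHS]big_mkcond; apply: eq_bigr => w _.
rewrite graph_sym eqxx andbT.
have -> : [ffun e : edge n => graph w (val e).1 (val e).2] = w.
  by apply/ffunP => e; rewrite ffunE mxE edge_betweenK.
rewrite eqxx andbT; case: ifP => _; last by rewrite mulr0.
rewrite mulr1 /sbm_pmf graph_sym eqxx pair_big_dep/= /bernoulli_pmf.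
rewrite (big_sub (fun e : 'I_n * 'I_n => (e.1 <= e.2)%N)
  (fun e => if graph w e.1 e.2 then edge_prob C p q e.1 e.2
            else 1 - edge_prob C p q e.1 e.2)).
by apply: eq_bigr => e _; rewrite mxE edge_betweenK.
Qed.

End sbm_product.

(** * Deviation of the adjacency matrix applied to a fixed vector *)

Section row_deviations.
Context {R : realType} {n : nat}.
Variables (C : {set 'I_n}) (p q : R).
Hypotheses (q_ge0 : 0 <= q) (q_le_p : q <= p) (p_le1 : p <= 1).
Implicit Types (w : {ffun edge n -> bool}) (x : 'cV[R]_n) (i j : 'I_n).

Lemma edge_prob01 i j : 0 <= edge_prob C p q i j <= 1.
Proof. rewrite /edge_prob; case: ifP => _; first by rewrite (le_trans q_ge0 q_le_p).
by rewrite q_ge0 (le_trans q_le_p). Qed.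

Lemma edge_law01 e : 0 <= edge_law C p q e <= 1.
Proof. exact: edge_prob01. Qed.

Let law := edge_law C p q.
Let E := expect law.

Lemma adjacency_graph w i j :
  adjacency (graph w) i j = (w (edge_between i j))%:R :> R.
Proof. by rewrite !mxE. Qed.

(** The entry [i] of [(A - E A) x]. *)
Definition row_deviation x i (G : 'M[bool]_n) : R :=
  \sum_j (adjacency G i j - edge_prob C p q i j) * x j 0.

Definition deviation x G : R := \sum_i `|row_deviation x i G|.

Lemma expect_row_deviation x i : E (fun w => row_deviation x i (graph w)) = 0.
Proof.
rewrite /E expect_sum big1// => j _.
have -> : (fun w => (adjacency (graph w) i j - edge_prob C p q i j) * x j 0) =
    (fun w => x j 0 * ((w (edge_between i j))%:R - edge_prob C p q i j)).
  by apply/funext => w; rewrite adjacency_graph mulrC.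
rewrite expectZ expectD expect_cst ?expect_coord; [|exact: edge_law01..].
by rewrite /law edge_law_between subrr mulr0.
Qed.

Lemma row_deviation_update x i w e :
  row_deviation x i (graph (update w e true)) -
  row_deviation x i (graph (update w e false)) =
  \sum_j (edge_between i j == e)%:R * x j 0.
Proof.
rewrite -sumrB; apply: eq_bigr => j _; rewrite -mulrBl.
have entry b : adjacency (graph (update w e b)) i j =
    (if edge_between i j == e then b else w (edge_between i j))%:R :> R.
  by rewrite adjacency_graph updateE.
congr (_ * _); set r := edge_prob _ _ _ _ _.
have -> (s t : R) : s - r - (t - r) = s - t by ring.
transitivity ((if edge_between i j == e then true else w (edge_between i j))%:R -
  (if edge_between i j == e then false else w (edge_between i j))%:R : R).
  by congr (_ - _); exact: entry.
by case: (_ == e); rewrite ?subr0 ?subrr.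
Qed.

(** The sum has at most one nonzero term, the one where [j] is the end of [e]
    other than [i]; the sum over [i] below has at most two. *)
Definition row_influence x i (e : edge n) : R :=
  \sum_j (edge_between i j == e)%:R * `|x j 0|.

Definition influence x (e : edge n) : R := \sum_i row_influence x i e.

Lemma row_deviation_differences x i :
  bounded_differences (row_influence x i) (fun w => row_deviation x i (graph w)).
Proof.
move=> e w; rewrite row_deviation_update (le_trans (ler_norm_sum _ _ _))//.
by apply: ler_sum => j _; rewrite normrM normr_nat.
Qed.

Lemma deviation_differences x :
  bounded_differences (influence x) (fun w => deviation x (graph w)).
Proof.
move=> e w; rewrite /deviation -sumrB (le_trans (ler_norm_sum _ _ _))//.
apply: ler_sum => i _; apply: le_trans (row_deviation_differences x i e w).
exact: ler_dist_dist.
Qed.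

Lemma row_edges_le1 i e : \sum_j (edge_between i j == e)%:R <= 1 :> R.
Proof.
rewrite sum_indicator -[leRHS]/(1%:R) ler_nat; apply/card_le1_eqP => j k.
by rewrite !unfold_in => /eqP <- /eqP /edge_between_inj.
Qed.

Lemma column_edges_le1 j e : \sum_i (edge_between i j == e)%:R <= 1 :> R.
Proof.
rewrite (eq_bigr (fun i => (edge_between j i == e)%:R)) ?row_edges_le1// => i _.
by rewrite edge_betweenC.
Qed.

(** A non-loop edge is met twice, once in each orientation. *)
Lemma edge_ends_le2 e :
  \sum_(ij : 'I_n * 'I_n) (edge_between ij.1 ij.2 == e)%:R <= 2 :> R.
Proof.
rewrite sum_indicator ler_nat.
pose s := [:: val e; ((val e).2, (val e).1)].
apply: leq_trans (card_size s); apply: subset_leq_card; apply/fintype.subsetP => -[i j].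
rewrite unfold_in /= edge_between_eq !inE => /orP[-> //|/eqP <- /=].
by rewrite eqxx orbT.
Qed.

Lemma row_influence_sqr x i e :
  row_influence x i e ^+ 2 <= \sum_j (edge_between i j == e)%:R * x j 0 ^+ 2.
Proof.
apply: le_trans (sqr_sum_le _ _) _.
under [X in _ * X <= _]eq_bigr do rewrite real_normK ?num_real//.
rewrite ler_piMl ?row_edges_le1//; apply: sumr_ge0 => j _.
by rewrite mulr_ge0 ?sqr_ge0.
Qed.

Lemma influence_sqr x e : influence x e ^+ 2 <=
  2 * \sum_i \sum_j (edge_between i j == e)%:R * x j 0 ^+ 2.
Proof.
rewrite /influence /row_influence !pair_big/=.
apply: le_trans (sqr_sum_le _ _) _.
under [X in _ * X <= _]eq_bigr do rewrite real_normK ?num_real//.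
rewrite ler_wpM2r ?edge_ends_le2//; apply: sumr_ge0 => j _.
by rewrite mulr_ge0 ?sqr_ge0.
Qed.

(** Regrouping by edges: this turns sums of squared influences into sums over
    pairs of vertices weighted by the edge probabilities. *)
Lemma edge_prob_sum i (y : 'I_n -> R) : \sum_j edge_prob C p q i j * y j =
  \sum_e law e * \sum_j (edge_between i j == e)%:R * y j.
Proof.
under [RHS]eq_bigr do rewrite mulr_sumr.
rewrite exchange_big/=; apply: eq_bigr => j _.
rewrite -edge_law_between -(sum_indicator_eq (edge_between i j)) mulr_suml.
by apply: eq_bigr => e _; rewrite mulrA.
Qed.

Lemma row_influence_variance x i : \sum_e law e * row_influence x i e ^+ 2 <=
  \sum_j edge_prob C p q i j * x j 0 ^+ 2.
Proof.
rewrite edge_prob_sum; apply: ler_sum => e _; have /andP[l0 _] := edge_law01 e.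
by rewrite ler_wpM2l// row_influence_sqr.
Qed.

Lemma influence_variance x : \sum_e law e * influence x e ^+ 2 <=
  2 * \sum_i \sum_j edge_prob C p q i j * x j 0 ^+ 2.
Proof.
under [X in _ <= _ * X]eq_bigr do rewrite edge_prob_sum.
rewrite exchange_big/= mulr_sumr.
apply: ler_sum => e _; have /andP[l0 _] := edge_law01 e.
by rewrite -mulr_sumr [leRHS]mulrCA ler_wpM2l// influence_sqr.
Qed.

Lemma row_deviation_second_moment x i :
  E (fun w => row_deviation x i (graph w) ^+ 2) <=
  \sum_j edge_prob C p q i j * x j 0 ^+ 2.
Proof.
apply: le_trans (row_influence_variance x i).
apply: le_trans (bounded_differences_second_moment edge_law01
  (row_deviation_differences x i)) _.
by rewrite [expect _ _]expect_row_deviation expr0n add0r.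
Qed.

(** Cauchy-Schwarz over the rows reduces the mean of the l1 norm to the variances
    of the rows. *)
Lemma expect_deviation_sqr x : E (fun w => deviation x (graph w)) ^+ 2 <=
  n%:R * \sum_i \sum_j edge_prob C p q i j * x j 0 ^+ 2.
Proof.
apply: le_trans (expect_sqr_le edge_law01 _) _.
apply: (@le_trans _ _
    (E (fun w => n%:R * \sum_i row_deviation x i (graph w) ^+ 2))).
  apply: expect_le => [|w]; first exact: edge_law01.
  have := cauchy_schwarz_sum (fun=> 1) (fun i => `|row_deviation x i (graph w)|).
  under eq_bigr do rewrite mul1r.
  under [X in _ <= X * _]eq_bigr do rewrite expr1n.
  under [X in _ <= _ * X]eq_bigr do rewrite real_normK ?num_real//.
  by rewrite sumr_const card_ord.
rewrite [E _]expectZ expect_sum ler_wpM2l ?ler0n//.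
by apply: ler_sum => i _; exact: row_deviation_second_moment.
Qed.

Lemma row_deviation_tail x i l t : (forall j, `|x j 0| <= 1) -> 0 <= l <= 1 / 2 ->
  prob law (fun w => t < `|row_deviation x i (graph w)|) <=
  2 * expR (- (l * t) + 2 * l ^+ 2 * \sum_j edge_prob C p q i j * x j 0 ^+ 2).
Proof.
move=> x1 /andP[l0 l12].
have lc e : l * row_influence x i e <= 1 / 2.
  apply: le_trans l12; rewrite ler_piMr//.
  apply: le_trans (row_edges_le1 i e); apply: ler_sum => j _.
  by rewrite ler_piMr// x1.
have := bounded_differences_tail_abs edge_law01 t
  (row_deviation_differences x i) l0 lc.
rewrite [expect _ _]expect_row_deviation.
under [prob _ _]eq_bigr do rewrite subr0.
move=> H; apply: le_trans H _.
rewrite ler_wpM2l// ler_expR lerD2l ler_wpM2l ?row_influence_variance//.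
by rewrite mulr_ge0 ?sqr_ge0.
Qed.

(** The exponent parameter is 1; the hypothesis on [x] is what the condition
    [l * c e <= 1 / 2] requires, as [influence x e] squared is at most twice
    the squared norm of [x]. *)
Lemma deviation_tail x t : 8 * \sum_j x j 0 ^+ 2 <= 1 ->
  prob law (fun w => t < deviation x (graph w) - E (fun w => deviation x (graph w))) <=
  expR (- t + 4 * \sum_i \sum_j edge_prob C p q i j * x j 0 ^+ 2).
Proof.
move=> x8.
have lc e : 1 * influence x e <= 1 / 2.
  have infl0 : 0 <= influence x e.
    by apply: sumr_ge0 => i _; apply: sumr_ge0 => j _; rewrite mulr_ge0.
  rewrite mul1r -(@ler_pXn2r _ 2)// ?nnegrE ?divr_ge0//.
  apply: le_trans (influence_sqr x e) _.
  suff : \sum_i \sum_j (edge_between i j == e)%:R * x j 0 ^+ 2 <=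
         \sum_j x j 0 ^+ 2 by lra.
  rewrite exchange_big/=; apply: ler_sum => j _.
  by rewrite -mulr_suml ler_piMl ?sqr_ge0// column_edges_le1.
apply: le_trans (bounded_differences_tail edge_law01 t
  (deviation_differences x) ler01 lc) _.
rewrite ler_expR mul1r lerD2l expr1n mulr1.
by have := influence_variance x; rewrite /law; lra.
Qed.

End row_deviations.

(** * Perturbation of the PageRank equation *)

Section pagerank_perturbation.
Context {R : realType} {n : nat}.
Implicit Types (M : 'M[R]_n) (v w x y z : 'cV[R]_n).

Definition norm1 x : R := \sum_i `|x i 0|.

Lemma norm1_ge0 x : 0 <= norm1 x.
Proof. exact: sumr_ge0. Qed.

Lemma ler_norm1D x y : norm1 (x + y) <= norm1 x + norm1 y.
Proof.
by rewrite /norm1 -big_split; apply: ler_sum => i _; rewrite mxE ler_normD.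
Qed.

Lemma norm1Z (a : R) x : norm1 (a *: x) = `|a| * norm1 x.
Proof. by rewrite /norm1 mulr_sumr; apply: eq_bigr => i _; rewrite mxE normrM. Qed.

Definition column_contraction M := forall j, \sum_i `|M i j| <= 1.

Lemma norm1_mulmx M x : column_contraction M -> norm1 (M *m x) <= norm1 x.
Proof.
move=> M1; apply: (@le_trans _ _ (\sum_i \sum_j `|M i j| * `|x j 0|)).
  apply: ler_sum => i _; rewrite mxE (le_trans (ler_norm_sum _ _ _))//.
  by apply: ler_sum => j _; rewrite normrM.
rewrite exchange_big/=; apply: ler_sum => j _.
by rewrite -mulr_suml ler_piMl.
Qed.

Variables (alpha : R).
Hypotheses (alpha_ge0 : 0 <= alpha) (alpha_lt1 : alpha < 1).

(** A kernel vector [y] satisfies [|y| <= alpha |y|] in the l1 norm. *)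
Lemma pagerank_system_unit M : column_contraction M ->
  1%:M - alpha *: M \in unitmx.
Proof.
move=> M1; rewrite -unitmx_tr -row_free_unit; apply: inj_row_free => y yM.
have : norm1 y^T = alpha * norm1 (M *m y^T).
  rewrite -{1}(ger0_norm alpha_ge0) -norm1Z; congr norm1.
  apply/eqP; rewrite -subr_eq0 -[X in _ *: (_ *m X)]/(y^T) scalemxAl -{1}(mul1mx y^T).
  by rewrite -mulmxBl -[X in X *m _]trmxK -trmx_mul yM trmx0.
have := norm1_mulmx y^T M1; have := norm1_ge0 y^T.
set N := norm1 y^T => N0 MN NE.
have N00 : N = 0.
  apply/eqP; rewrite eq_le N0 andbT -(@pmulr_rle0 _ (1 - alpha)) ?subr_gt0//.
  rewrite mulrBl mul1r subr_le0 {1}NE; exact: ler_wpM2l.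
apply/rowP => j; move/eqP: N00; rewrite /N psumr_eq0 => [|//].
by move=> /allP/(_ j (mem_index_enum _)); rewrite /= normr_eq0 !mxE => /eqP.
Qed.

(** The difference [z] of the two solutions satisfies
    [z = alpha M z + alpha (M - M0) w], and [M] contracts the l1 norm.  Only [w]
    is multiplied by the error matrix. *)
Lemma pagerank_perturbation M M0 v w : column_contraction M ->
  w = alpha *: (M0 *m w) + (1 - alpha) *: v ->
  norm1 ((1 - alpha) *: (invmx (1%:M - alpha *: M) *m v) - w) <=
  alpha / (1 - alpha) * norm1 ((M - M0) *m w).
Proof.
move=> M1 wE; have Mu := pagerank_system_unit M1.
set x := (1 - alpha) *: _.
have xE : x = alpha *: (M *m x) + (1 - alpha) *: v.
  have : (1%:M - alpha *: M) *m x = (1 - alpha) *: v.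
    by rewrite /x -scalemxAr mulmxA mulmxV// mul1mx.
  by rewrite mulmxBl mul1mx -scalemxAl => /eqP; rewrite subr_eq addrC => /eqP.
have zE : x - w = alpha *: (M *m (x - w)) + alpha *: ((M - M0) *m w).
  rewrite {1}xE {1}wE mulmxBr mulmxBl -scalerDr addrA subrK opprD addrACA subrr addr0.
  by rewrite -scalerBr.
have a1 : 0 < 1 - alpha by rewrite subr_gt0.
have : norm1 (x - w) <= alpha * norm1 (x - w) + alpha * norm1 ((M - M0) *m w).
  rewrite {1}zE (le_trans (ler_norm1D _ _))// !norm1Z ger0_norm// lerD2r.
  by rewrite ler_wpM2l// norm1_mulmx.
rewrite mulrAC ler_pdivlMr//; nra.
Qed.

Lemma transition_degree (G : 'M[bool]_n) i j : positive_degrees (R := R) G ->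
  transition G i j * degree G j = adjacency G i j :> R.
Proof.
move=> /forallP dG.
pose D : 'M[R]_n := diag_mx (\row_i degree G i).
have Du : D \in unitmx.
  rewrite unitmxE det_diag unitfE; apply/prodf_neq0 => k _.
  by rewrite mxE gt_eqF.
have : (transition G *m D) i j = adjacency G i j by rewrite mulmxKV.
by rewrite mul_mx_diag !mxE.
Qed.

Lemma transition_column_contraction (G : 'M[bool]_n) : G^T = G ->
  positive_degrees (R := R) G -> column_contraction (transition G).
Proof.
move=> Gs dG j; have dj : 0 < degree G j :> R by have /forallP := dG.
rewrite -(ler_pM2r dj) mul1r mulr_suml.
rewrite (eq_bigr (fun i => adjacency G j i)) ?lexx// => i _.
rewrite -[X in _ * X](gtr0_norm dj) -normrM transition_degree// ger0_norm.
  by rewrite !mxE -{1}Gs mxE.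
by rewrite mxE ler0n.
Qed.

End pagerank_perturbation.

Section degree_perturbation.
Context {R : realType} {n : nat}.
Variables (C : {set 'I_n}) (p q alpha d s : R) (v w : 'cV[R]_n).
Hypotheses (alpha_ge0 : 0 <= alpha) (alpha_lt1 : alpha < 1) (d_gt0 : 0 < d).
Hypothesis w_fixed :
  w = alpha *: ((\matrix_(i, j) (edge_prob C p q i j / d)) *m w) + (1 - alpha) *: v.

Lemma dTV_norm1 (x y : 'cV[R]_n) : dTV x y = 2^-1 * norm1 (x - y).
Proof. by congr (_ * _); apply: eq_bigr => i _; rewrite !mxE. Qed.

(** With [T] the transition matrix and [d_j] the degrees,
    [(T - Pbar) w] is the sum of [T y], where [y j = (1 - d_j / d) w j], and of
    [(A - E A) w / d]; the contraction property of [T] bounds the first term by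
    the l1 norm of [y]. *)
Lemma pagerank_deviation (G : 'M[bool]_n) : G^T = G -> s < d ->
  (forall i, `|degree G i - d| <= s) ->
  positive_degrees (R := R) G /\
  dTV (pagerank alpha v G) w <=
  alpha / (1 - alpha) * ((s * norm1 w + deviation C p q w G) / d).
Proof.
move=> Gs sd dev.
have dpos : positive_degrees (R := R) G.
  apply/forallP => i; have := dev i; rewrite ler_norml => /andP[+ _]; lra.
split=> //.
have T1 := transition_column_contraction Gs dpos.
have a0 : 0 <= alpha / (1 - alpha) by rewrite divr_ge0// subr_ge0 ltW.
rewrite dTV_norm1; have := pagerank_perturbation alpha_ge0 alpha_lt1 T1 w_fixed.
set T := transition G; set P := \matrix_(i, j) _; rewrite -/(pagerank alpha v G) => H.
apply: (@le_trans _ _ (norm1 (pagerank alpha v G - w))).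
  by rewrite ler_piMl ?norm1_ge0//; lra.
apply: le_trans H _; rewrite ler_wpM2l//.
pose y : 'cV[R]_n := \col_j ((1 - degree G j / d) * w j 0).
pose z : 'cV[R]_n := \col_i row_deviation C p q w i G.
have -> : (T - P) *m w = T *m y + d^-1 *: z.
  apply/colP => i; rewrite [LHS]mxE [RHS]mxE [X in _ = X + _]mxE.
  rewrite [X in _ = _ + X]mxE [z i 0]mxE mulr_sumr -big_split.
  apply: eq_bigr => j _ /=; rewrite [y j 0]mxE [(T - P) i j]mxE [(- P) i j]mxE.
  rewrite [P i j]mxE -(transition_degree i j dpos) -/T; field; exact: lt0r_neq0.
apply: le_trans (ler_norm1D _ _) _.
have dV0 : 0 < d^-1 by rewrite invr_gt0.
rewrite norm1Z (gtr0_norm dV0) mulrDl [deviation _ _ _ _ _ / d]mulrC lerD//; last first.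
  by rewrite /norm1 /deviation le_eqVlt; apply/orP; left; apply/eqP;
     congr (_ * _); apply: eq_bigr => i _; rewrite mxE.
apply: le_trans (norm1_mulmx _ T1) _.
rewrite mulrAC /norm1 mulr_sumr; apply: ler_sum => j _.
rewrite mxE normrM ler_wpM2r//.
have -> : 1 - degree G j / d = - ((degree G j - d) / d).
  by field; exact: lt0r_neq0.
by rewrite normrN normrM (gtr0_norm dV0) ler_wpM2r// ltW.
Qed.

End degree_perturbation.

(** * The limit vector for communities of equal size *)

Section balanced_communities.
Context {R : realType} {n : nat}.
Variables (C : {set 'I_n}) (p q : R).
Hypotheses (n_gt0 : (0 < n)%N) (n_even : ~~ odd n) (C_half : #|C| = n./2).
Hypotheses (pq_gt0 : 0 < p + q).

Let u : 'cV[R]_n := community_vector C.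
Let beta : R := (p - q) / (p + q).
Let d : R := n%:R * (p + q) / 2.

Lemma nat_gt0R : 0 < n%:R :> R. Proof. by rewrite ltr0n. Qed.

Lemma community_vector_sqr i : u i 0 ^+ 2 = n%:R^-1.
Proof.
by rewrite mxE; case: ifP => _; rewrite ?sqrrN exprVn sqr_sqrtr ?ler0n.
Qed.

Lemma sum_community_vector_sqr : \sum_i u i 0 ^+ 2 = 1.
Proof.
rewrite (eq_bigr _ (fun i _ => community_vector_sqr i)) sumr_const card_ord.
by rewrite -(mulr_natr n%:R^-1) mulVf// lt0r_neq0 ?nat_gt0R.
Qed.

Lemma sum_community_vector : \sum_i u i 0 = 0.
Proof.
rewrite (bigID (mem C))/=.
rewrite (eq_bigr (fun=> (Num.sqrt n%:R)^-1)) => [|i iC]; last by rewrite mxE iC.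
rewrite [X in _ + X](eq_bigr (fun=> - (Num.sqrt n%:R)^-1)) => [|i /negbTE iC];
  last by rewrite mxE iC.
rewrite !sumr_const -[X in _ + _ *+ X](_ : #|~: C| = _); last first.
  by apply: eq_card => i; rewrite !inE.
rewrite -(addnK #|C| #|~: C|) [(_ + #|C|)%N]addnC cardsC card_ord C_half.
have -> : (n - n./2)%N = n./2.
  by rewrite -{1}(odd_double_half n) (negbTE n_even) add0n -addnn addnK.
by rewrite mulNrn subrr.
Qed.

(** Each entry of the expected adjacency matrix is [(p + q) / 2] plus or minus
    [(p - q) / 2], and the sign is that of the product of the entries of [u]. *)
Lemma edge_prob_rank2 i j :
  edge_prob C p q i j = d * (n%:R^-1 + beta * u i 0 * u j 0).
Proof.
have uu (a b : R) : a ^+ 2 = n%:R^-1 -> b = a \/ b = - a ->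
  d * (n%:R^-1 + beta * a * b) = if b == a then p else q.
  move=> a2 ab.
  have n0 := lt0r_neq0 nat_gt0R; have pq0 := lt0r_neq0 pq_gt0.
  have a0 : a != 0 by rewrite -sqrf_eq0 a2 invr_eq0.
  rewrite -mulrA /d /beta; case: ab => ->.
    rewrite eqxx -expr2 a2; field; exact/andP.
  have -> : (- a == a) = false.
    by rewrite eqNr (negbTE a0).
  rewrite mulrN -expr2 a2; field; exact/andP.
have u2 := community_vector_sqr i.
rewrite uu ?u2//.
  rewrite /edge_prob !mxE.
  set r : R := (Num.sqrt n%:R)^-1.
  have r0 : r != 0 by rewrite invr_eq0 sqrtr_eq0 -ltNge nat_gt0R.
  have rN : (- r == r) = false by rewrite eqNr (negbTE r0).
  have Nr : (r == - r) = false by rewrite eq_sym.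
  by case: (i \in C); case: (j \in C); rewrite ?eqxx ?rN ?Nr.
rewrite !mxE; case: (i \in C); case: (j \in C); rewrite ?opprK; by [left|right].
Qed.

Lemma expected_degree i : \sum_j edge_prob C p q i j = d.
Proof.
under eq_bigr do rewrite edge_prob_rank2.
rewrite -mulr_sumr big_split/= -mulr_sumr sum_community_vector mulr0 addr0.
by rewrite sumr_const card_ord -(mulr_natr n%:R^-1) mulVf ?mulr1// lt0r_neq0 ?nat_gt0R.
Qed.

Lemma expected_degree_weighted (f : 'I_n -> R) :
  \sum_i \sum_j edge_prob C p q i j * f j = d * \sum_j f j.
Proof.
rewrite exchange_big/= mulr_sumr; apply: eq_bigr => j _.
rewrite -mulr_suml; congr (_ * _); rewrite -(expected_degree j).
by apply: eq_bigr => i _; exact: edge_probC.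
Qed.

Variables (alpha : R) (v : 'cV[R]_n).
Hypotheses (alpha_ge0 : 0 <= alpha) (alpha_lt1 : alpha < 1).
Hypotheses (q_ge0 : 0 <= q) (q_le_p : q <= p) (v_sum : \sum_i v i 0 = 1).

Let w := pagerank_sbm alpha p q C v.
Let m := \sum_i v i 0 * u i 0.
Let k := alpha * beta / (1 - alpha * beta).

Lemma pagerank_sbmE i :
  w i 0 = alpha / n%:R + (1 - alpha) * (v i 0 + k * m * u i 0).
Proof.
rewrite /w /pagerank_sbm !mxE mulr1; congr (_ + _ * (_ + _ * _ * _)).
by apply: eq_bigr => j _; rewrite !mxE.
Qed.

Lemma beta01 : 0 <= beta <= 1.
Proof.
apply/andP; split; first by rewrite divr_ge0 ?subr_ge0// ltW.
by rewrite ler_pdivrMr// mul1r lerD2l (le_trans _ q_ge0)// oppr_le0.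
Qed.

Lemma alpha_beta_le : alpha * beta <= alpha.
Proof. by have /andP[b0 b1] := beta01; rewrite ler_piMr. Qed.

(** On the orthonormal pair formed by [u] and the normalized all-ones vector, the
    averaged matrix acts by [beta] and 1, and it kills the orthogonal
    complement; [k] is the sum of the powers of [alpha * beta] from the first
    one on, as in the Neumann series of the resolvent. *)
Lemma pagerank_sbm_fixed :
  w = alpha *: ((\matrix_(i, j) (edge_prob C p q i j / d)) *m w) +
      (1 - alpha) *: v.
Proof.
have n0 := lt0r_neq0 nat_gt0R.
have d0 : d != 0.
  by rewrite /d mulf_neq0 ?invr_eq0// ?mulf_neq0// lt0r_neq0.
have mulw i : ((\matrix_(i, j) (edge_prob C p q i j / d)) *m w) i 0 =
    n%:R^-1 * (\sum_j w j 0) + beta * u i 0 * \sum_j u j 0 * w j 0.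
  rewrite mxE !mulr_sumr -big_split; apply: eq_bigr => j _ /=.
  by rewrite mxE edge_prob_rank2 [d * _]mulrC mulfK//; ring.
have sumw : \sum_j w j 0 = 1.
  under eq_bigr do rewrite pagerank_sbmE.
  rewrite big_split/= -[X in _ + X]mulr_sumr big_split/= v_sum.
  rewrite -[X in _ * (_ + X)]mulr_sumr.
  rewrite sum_community_vector mulr0 addr0 sumr_const card_ord.
  rewrite -(mulr_natr (alpha / n%:R)).
  by rewrite divfK// mulr1 addrC subrK.
have sumuw : \sum_j u j 0 * w j 0 = (1 - alpha) * (m + k * m).
  under eq_bigr => j _.
    rewrite pagerank_sbmE.
    have -> : u j 0 * (alpha / n%:R + (1 - alpha) * (v j 0 + k * m * u j 0)) =
      alpha / n%:R * u j 0 + (1 - alpha) * (v j 0 * u j 0 + k * m * u j 0 ^+ 2) by ring.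
    over.
  rewrite big_split/= -!mulr_sumr sum_community_vector mulr0 add0r big_split/=.
  by rewrite -mulr_sumr sum_community_vector_sqr mulr1.
apply/colP => i; rewrite [RHS]mxE [X in _ = X + _]mxE [X in _ = _ + X]mxE.
rewrite mulw sumw sumuw pagerank_sbmE.
have ab : 1 - alpha * beta != 0.
  by rewrite lt0r_neq0// subr_gt0 (le_lt_trans alpha_beta_le).
by rewrite /k; field; apply/andP.
Qed.

(** The coefficients of the three components of [w] lie between 0 and 1; for the
    last one this uses [alpha * beta <= alpha]. *)
Lemma pagerank_sbm_norm :
  \sum_i w i 0 ^+ 2 <= 3 * (n%:R^-1 + 2 * \sum_i v i 0 ^+ 2).
Proof.
have /andP[b0 b1] := beta01; have ab1 := alpha_beta_le.
pose K := (1 - alpha) * k.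
have K01 : 0 <= K <= 1.
  have ab0 : 0 <= alpha * beta by rewrite mulr_ge0.
  have ab : 0 < 1 - alpha * beta by rewrite subr_gt0 (le_lt_trans ab1).
  have a1 : 0 <= 1 - alpha by rewrite subr_ge0 ltW.
  rewrite /K /k mulrA; apply/andP; split.
    by apply: divr_ge0; [exact: mulr_ge0 | exact: ltW].
  rewrite ler_pdivrMr// mul1r.
  have : (1 - alpha) * (alpha * beta) <= (1 - alpha) * 1.
    by rewrite ler_wpM2l// (le_trans ab1)// ltW.
  lra.
have m2 : m ^+ 2 <= \sum_i v i 0 ^+ 2.
  have := cauchy_schwarz_sum (fun i => v i 0) (fun i => u i 0).
  by rewrite sum_community_vector_sqr mulr1.
have H i : w i 0 ^+ 2 <= 3 * (n%:R^-1 ^+ 2 + v i 0 ^+ 2 + m ^+ 2 * u i 0 ^+ 2).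
  have -> : w i 0 = alpha * n%:R^-1 + (1 - alpha) * v i 0 + K * (m * u i 0).
    by rewrite pagerank_sbmE /K; ring.
  rewrite -exprMn.
  have S3 (x y z : R) : (x + y + z) ^+ 2 <= 3 * (x ^+ 2 + y ^+ 2 + z ^+ 2).
    have := sqr_ge0 (x - y); have := sqr_ge0 (y - z); have := sqr_ge0 (x - z).
    nra.
  have S1 (a x : R) : 0 <= a <= 1 -> (a * x) ^+ 2 <= x ^+ 2.
    move=> /andP[a0 a1]; rewrite exprMn ler_piMl ?sqr_ge0//.
    by rewrite expr_le1.
  apply: le_trans (S3 _ _ _) _; rewrite ler_wpM2l// !lerD// S1//.
    by rewrite alpha_ge0 ltW.
  by rewrite subr_ge0 ltW//= gerBl.
apply: le_trans (ler_sum _ (fun i _ => H i)) _.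
rewrite -mulr_sumr ler_wpM2l// !big_split/= -[X in _ + X <= _]mulr_sumr.
rewrite sum_community_vector_sqr.
rewrite sumr_const card_ord -(mulr_natr (n%:R^-1 ^+ 2)) expr2 mulfVK ?lt0r_neq0 ?nat_gt0R//.
by move: m2; lra.
Qed.

End balanced_communities.

(** * The finite-size estimate and the limit *)

Section finite_size_bound.
Context {R : realType} {n : nat}.
Variables (C : {set 'I_n}) (p q : R).
Hypotheses (n_gt0 : (0 < n)%N) (n_even : ~~ odd n) (C_half : #|C| = n./2).
Hypotheses (q_ge0 : 0 <= q) (q_lt_p : q < p) (p_le1 : p <= 1).

Let d : R := n%:R * (p + q) / 2.

Let pq_gt0 : 0 < p + q.
Proof. by rewrite ltr_wpDr// (le_lt_trans q_ge0). Qed.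

Let q_le_p : q <= p. Proof. exact: ltW. Qed.

(** Degrees are the case of the all-ones vector, so one concentration inequality
    serves both error terms. *)
Lemma row_deviation_degree i (G : 'M[bool]_n) :
  row_deviation C p q (const_mx 1) i G = degree G i - d.
Proof.
rewrite -[d](expected_degree n_gt0 n_even C_half pq_gt0 i) -sumrB.
by apply: eq_bigr => j _; rewrite [const_mx _ _ _]mxE mulr1.
Qed.

Definition good_graph (x : 'cV[R]_n) (s t : R) (G : 'M[bool]_n) : bool :=
  [&& G^T == G, [forall i, `|degree G i - d| <= s] &
      deviation C p q x G <= Num.sqrt (n%:R * (d * \sum_j x j 0 ^+ 2)) + t].

Lemma good_graph_prob (x : 'cV[R]_n) (l s t : R) :
  8 * \sum_j x j 0 ^+ 2 <= 1 -> 0 <= l <= 1 / 2 ->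
  1 - (n%:R * (2 * expR (- (l * s) + 2 * l ^+ 2 * d)) +
       expR (- t + 4 * (d * \sum_j x j 0 ^+ 2))) <=
  sbm_prob C p q (good_graph x s t).
Proof.
move=> x8 l12; set S := \sum_j _.
have dS : \sum_i \sum_j edge_prob C p q i j * x j 0 ^+ 2 = d * S.
  exact: expected_degree_weighted.
have law01 := edge_law01 C q_ge0 q_le_p p_le1.
rewrite sbm_prob_product lerBlDr.
pose far i (w : {ffun edge n -> bool}) :=
  s < `|row_deviation C p q (const_mx 1) i (graph w)|.
pose m := expect (edge_law C p q) (fun w => deviation C p q x (graph w)).
pose large (w : {ffun edge n -> bool}) := t < deviation C p q x (graph w) - m.
have m_le : m <= Num.sqrt (n%:R * (d * S)).
  rewrite (le_trans (ler_norm m))// -sqrtr_sqr ler_wsqrtr//.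
  rewrite -dS.
  exact: expect_deviation_sqr.
have far_le i : prob (edge_law C p q) (far i) <=
    2 * expR (- (l * s) + 2 * l ^+ 2 * d).
  have := row_deviation_tail C q_ge0 q_le_p p_le1 (x := const_mx 1) i s
    (fun j => _) l12.
  rewrite (_ : \sum_j _ = d).
    by apply => j; rewrite mxE normr1.
  rewrite -[d](expected_degree n_gt0 n_even C_half pq_gt0 i).
  by apply: eq_bigr => j _; rewrite mxE expr1n mulr1.
have large_le : prob (edge_law C p q) large <= expR (- t + 4 * (d * S)).
  rewrite -dS.
  exact: deviation_tail.
(* Union bound: pointwise, the indicators of the good event and of the bad
   ones sum to at least 1. *)
apply: (@le_trans _ _ (prob (edge_law C p q) (fun w => good_graph x s t (graph w)) +
    (\sum_i prob (edge_law C p q) (far i) + prob (edge_law C p q) large))); last first.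
  rewrite lerD2l lerD//.
  apply: le_trans (ler_sum _ (fun i _ => far_le i)) _.
  by rewrite sumr_const card_ord -[_ *+ n]mulr_natl.
rewrite -expect_sum -!expectD -[leLHS](expect_cst (edge_law C p q)).
apply: expect_le => // w; rewrite -natr_sum -!natrD -[leLHS]/(1%:R) ler_nat.
case: (boolP (good_graph x s t (graph w))) => //=.
rewrite /good_graph graph_sym eqxx /= negb_and => /orP[/forallPn[i]|].
  rewrite -row_deviation_degree -ltNge -/(far i w) => fi.
  by rewrite (bigD1 i)//= fi.
rewrite -ltNge => large_dev.
have -> : large w by rewrite /large ltrBrDl (le_lt_trans _ large_dev)// lerD2r.
by rewrite addn1.
Qed.

Variables (alpha M : R) (v : 'cV[R]_n).
Hypotheses (alpha_ge0 : 0 <= alpha) (alpha_lt1 : alpha < 1).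
Hypothesis v_sum : \sum_i v i 0 = 1.

Let w := pagerank_sbm alpha p q C v.

(** Relative degree error [4 sqrt r] with exponent parameter [sqrt r], and
    fluctuation [2 ln n] of the deviation: both failure probabilities are then
    multiples of [n^(-2)], and the union bound over the degrees loses a factor
    [n].  The condition on [r] makes the degree error smaller than 1 and the
    exponent parameter admissible. *)
Lemma pagerank_sbm_prob (r : R) :
  \sum_i w i 0 ^+ 2 <= M / n%:R -> 8 * M <= n%:R ->
  1 <= ln n%:R :> R -> r * d = ln n%:R -> 32 * r <= 1 ->
  1 - (2 + expR (4 * M)) * n%:R^-1 <=
  sbm_prob C p q [pred G | positive_degrees (R := R) G &&
    (dTV (pagerank alpha v G) w <=
     alpha / (1 - alpha) * ((5 * Num.sqrt M + 2) * Num.sqrt r))].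
Proof.
set S := \sum_i _ => SM M8 ln1 rd r32.
have n0 : 0 < n%:R :> R by rewrite ltr0n.
have d0 : 0 < d by rewrite /d divr_gt0// mulr_gt0.
have dn : d <= n%:R.
  rewrite /d ler_pdivrMr// ler_wpM2l// ?ler0n//.
  by have := q_le_p; have := p_le1; lra.
have r0 : 0 < r by rewrite -(pmulr_lgt0 _ d0) rd; lra.
have S0 : 0 <= S by apply: sumr_ge0 => i _; exact: sqr_ge0.
have nS : n%:R * S <= M by rewrite mulrC -ler_pdivlMr.
have M0 : 0 <= M by rewrite (le_trans _ nS)// mulr_ge0 ?ler0n.
have dS : d * S <= M by rewrite (le_trans _ nS)// ler_wpM2r.
have S8 : 8 * S <= 1.
  rewrite -(ler_pM2l n0) mulr1 (le_trans _ M8)// mulrCA ler_wpM2l//.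
pose a := Num.sqrt r.
have a0 : 0 <= a by exact: sqrtr_ge0.
have a2 : a ^+ 2 = r by rewrite sqr_sqrtr// ltW.
have a16 : 4 * a < 1.
  rewrite -(@ltr_pXn2r _ 2)// ?nnegrE ?mulr_ge0// exprMn a2 expr1n; lra.
have l12 : 0 <= a <= 1 / 2 by rewrite a0; lra.
have := good_graph_prob (4 * a * d) (2 * (r * d)) S8 l12.
rewrite -/S => good_prob.
have expn : expR (- (2 * (r * d))) = n%:R^-1 ^+ 2 :> R.
  by rewrite rd -mulrN mulr_natl mulr2n expRD expRN lnK ?posrE// expr2.
have n1 : n%:R^-1 <= 1 :> R by rewrite invf_le1// ler1n.
apply: (@le_trans _ _ _ _ _ (le_trans _ good_prob)).
  rewrite lerD2l lerN2.
  have -> : - (a * (4 * a * d)) + 2 * a ^+ 2 * d = - (2 * (r * d)).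
    by rewrite -a2; ring.
  rewrite expRD expn [leRHS]mulrDl lerD//.
    by rewrite mulrCA expr2 mulVKf ?lt0r_neq0.
  rewrite mulrC ler_pM ?expR_ge0 ?sqr_ge0// ?ler_expR ?ler_wpM2l//.
  by rewrite expr2 ler_piMr ?invr_ge0 ?ler0n.
rewrite !sbm_prob_product; apply: prob_le => [|G'].
  exact: edge_law01.
rewrite -!topredE /=; set G := graph G' => /and3P[/eqP Gs /forallP deg dev].
have sd : 4 * a * d < d by rewrite gtr_pMl.
have wE := pagerank_sbm_fixed n_gt0 n_even C_half pq_gt0 alpha_ge0 alpha_lt1
  q_ge0 q_le_p v_sum.
have [-> /= TV] := pagerank_deviation alpha_ge0 alpha_lt1 d0 wE Gs sd deg.
apply: le_trans TV _.
rewrite ler_wpM2l ?divr_ge0// ?subr_ge0 ?(ltW alpha_lt1)//.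
have w1 : norm1 w <= Num.sqrt M.
  rewrite (le_trans (ler_norm _))// -sqrtr_sqr ler_wsqrtr// (le_trans _ nS)//.
  have := cauchy_schwarz_sum (fun=> 1) (fun i => `|w i 0|).
  under eq_bigr do rewrite mul1r.
  under [X in _ <= X * _]eq_bigr do rewrite expr1n.
  under [X in _ <= _ * X]eq_bigr do rewrite real_normK ?num_real//.
  by rewrite sumr_const card_ord.
have sq : Num.sqrt (n%:R * (d * S)) <= Num.sqrt M * (a * d).
  have ad0 : 0 <= a * d by rewrite mulr_ge0// ltW.
  rewrite -(ger0_norm ad0) -sqrtr_sqr -sqrtrM// ler_wsqrtr//.
  have -> : (a * d) ^+ 2 = ln n%:R * d by rewrite exprMn a2 expr2 mulrA rd.
  apply: (@le_trans _ _ (M * d)); first by rewrite mulrCA mulrC ler_wpM2r// ltW.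
  by rewrite ler_wpM2l// ler_peMl// ltW.
have ra : r <= a by rewrite -a2 expr2 ler_piMr//; lra.
rewrite ler_pdivrMr//.
have t1 : 4 * a * d * norm1 w <= 4 * a * d * Num.sqrt M.
  by rewrite ler_wpM2l// !mulr_ge0// ltW.
have t2 : r * d <= a * d by rewrite ler_wpM2r// ltW.
rewrite -/a.
apply: le_trans (lerD t1 (le_trans dev (lerD sq (ler_wpM2l _ t2)))) _ => //.
by rewrite le_eqVlt; apply/orP; left; apply/eqP; ring.
Qed.

End finite_size_bound.

Theorem corollary2 (R : realType) (alpha : R) (p q : nat -> R)
    (C : forall n : nat, {set 'I_n}) (v : forall n : nat, 'cV[R]_n)
    (alpha_ge0 : 0 <= alpha) (alpha_lt1 : alpha < 1)
    (pq : forall n : nat, (0 < n)%N -> ~~ odd n ->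
      [/\ 0 <= q n, q n < p n & p n <= 1])
    (C_half : forall n : nat, ~~ odd n -> #|C n| = n./2)
    (v_prob : forall n : nat, (0 < n)%N -> ~~ odd n -> prob_vector (v n))
    (pq_log : (fun n : nat => ln (n%:R : R) ^+ 3 / n%:R)
                =o_even_oo (fun n : nat => p n + q n))
    (v_norm : (fun n : nat => norm2 (v n))
                =O_even_oo (fun n : nat => (Num.sqrt (n%:R : R))^-1)) :
  cvg0_whp (fun n => sbm_prob (C n) (p n) (q n))
    (fun n => positive_degrees (R := R))
    (fun n G => dTV (pagerank alpha (v n) G)
                    (pagerank_sbm alpha (p n) (q n) (C n) (v n))).
Proof.
have [B B0 vB] := (eqO_exP _ _ _).1 v_norm.
have even_near : \forall n \near even_oo, ~~ odd n by exact: withinT.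
have large_near x : \forall n \near even_oo, x <= n%:R :> R.
  by apply: cvg_within; exact: nbhs_infty_ger.
have ln_ge1 : \forall n \near even_oo, 1 <= ln n%:R :> R.
  have := large_near (expR 1); apply: filterS => n n3.
  by rewrite -[leLHS]expRK ler_ln ?posrE ?expR_gt0// (lt_le_trans _ n3) ?expR_gt0.
pose d n : R := n%:R * (p n + q n) / 2.
pose r n : R := ln n%:R / d n.
have d_gt0 n : (0 < n)%N -> ~~ odd n -> 0 < d n.
  move=> n0 ne; have [q0 qp p1] := pq n n0 ne.
  by rewrite divr_gt0// mulr_gt0 ?ltr0n// ltr_wpDr// (le_lt_trans q0).
(* Since [1 <= ln n], the hypothesis on [ln n ^+ 3] controls [ln n] itself. *)
have small_r e : 0 < e -> \forall n \near even_oo, 0 <= r n <= e.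
  move=> e0; have := (eqoP _ _ _).1 pq_log (e / 2) (divr_gt0 e0 (ltr0n _ 2)).
  move=> log_small; near=> n.
  have n1 : 1 <= n%:R :> R by near: n.
  have n0 : (0 < n)%N by rewrite -(ler1n R).
  have ne : ~~ odd n by near: n.
  have dn := d_gt0 n n0 ne; have [q0 qp p1] := pq n n0 ne.
  have l1 : 1 <= ln n%:R :> R by near: n.
  have l0 : 0 <= ln n%:R :> R by rewrite (le_trans _ l1).
  rewrite divr_ge0 ?(ltW dn)//= ler_pdivrMr//.
  have : `|ln n%:R ^+ 3 / n%:R : R| <= e / 2 * `|p n + q n| by near: n.
  have pq0 : 0 <= p n + q n by rewrite addr_ge0// (le_trans q0)// ltW.
  have ln3 : 0 <= ln n%:R ^+ 3 / n%:R :> R by rewrite divr_ge0 ?exprn_ge0.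
  rewrite !ger0_norm// ler_pdivrMr ?ltr0n// => ln3_le.
  have -> : e * d n = e / 2 * (p n + q n) * n%:R by rewrite /d; field.
  apply: le_trans ln3_le.
  by rewrite exprS ler_peMr// exprn_ege1.
(* [M / n] bounds the squared norm of the limit vector when [B / sqrt n]
   bounds the norm of the preference vector. *)
pose M : R := 3 * (1 + 2 * B ^+ 2).
exists (fun n => alpha / (1 - alpha) * ((5 * Num.sqrt M + 2) * Num.sqrt (r n))).
  have r_cvg : r n @[n --> even_oo] --> (0 : R).
    apply/cvgr0Pnorm_le => e e0; have := small_r e e0; apply: filterS => n.
    by move=> /andP[r0 re]; rewrite ger0_norm.
  have sqrt_cvg : Num.sqrt (r n) @[n --> even_oo] --> (0 : R).
    rewrite -[X in _ --> X]sqrtr0.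
    by apply: continuous_cvg => //; exact: sqrt_continuous.
  rewrite -[X in _ --> X](mulr0 (alpha / (1 - alpha))); apply: cvgMl_tmp.
  rewrite -[X in _ --> X](mulr0 (5 * Num.sqrt M + 2)); exact: cvgMl_tmp.
exists 1 => //; exists (2 + expR (4 * M)).
near=> n.
have n1 : 1 <= n%:R :> R by near: n.
have n0 : (0 < n)%N by rewrite -(ler1n R).
have ne : ~~ odd n by near: n.
have [q0 qp p1] := pq n n0 ne; have [v0 v1] := v_prob n n0 ne.
rewrite powR_inv1 ?ler0n//.
have dn := d_gt0 n n0 ne.
apply: pagerank_sbm_prob => //.
- exact: C_half.
- have pq_gt0 : 0 < p n + q n by rewrite ltr_wpDr// (le_lt_trans q0).
  apply: le_trans (pagerank_sbm_norm (C n) n0 pq_gt0 (v n) alpha_ge0 alpha_lt1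
    q0 (ltW qp)) _.
  rewrite /M -mulrA ler_wpM2l// [leRHS]mulrDl mul1r lerD2l.
  rewrite -[leRHS]mulrA ler_wpM2l//.
  have : `|norm2 (v n)| <= B * `|(Num.sqrt (n%:R : R))^-1| by near: n.
  rewrite ger0_norm ?sqrtr_ge0// ger0_norm ?invr_ge0 ?sqrtr_ge0// => v_le.
  have -> : \sum_i v n i 0 ^+ 2 = norm2 (v n) ^+ 2.
    rewrite sqr_sqrtr ?sumr_ge0//.
    by apply: eq_bigr => i _; rewrite real_normK ?num_real.
  have -> : n%:R^-1 = (Num.sqrt n%:R)^-1 ^+ 2 :> R by rewrite exprVn sqr_sqrtr ?ler0n.
  by rewrite -exprMn lerXn2r// nnegrE ?mulr_ge0 ?sqrtr_ge0 ?invr_ge0// ltW.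
- by near: n.
- by near: n.
- by rewrite divfK// lt0r_neq0.
- suff : 0 <= r n <= 32^-1.
    by move=> /andP[_]; rewrite -[leRHS]mul1r ler_pdivlMr// mulrC.
  by near: n; apply: small_r.
Unshelve. all: by end_near.
Qed.
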